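(* Let $K,M\ge 1$, let $\mathbf{h}_1,\dots,\mathbf{h}_K\in\mathbb{C}^{1\times M}$ be the rows of $\mathbf{H}\in\mathbb{C}^{K\times M}$, let $\mathbf{d}=(d_1,\dots,d_K)$ with $d_j\in\mathbb{C}$, $|d_j|=1$, and let $\boldsymbol\zeta=(\zeta_1,\dots,\zeta_K)$ with $\zeta_j>0$. Consider the problem $$(\mathrm{CIPM})\qquad \min_{\mathbf{x}\in\mathbb{C}^{M\times 1}} \ \operatorname{tr}(\mathbf{x}\mathbf{x}^H)\quad\text{s.t.}\quad \angle(\mathbf{h}_j\mathbf{x})=\angle(d_j),\quad \mathbf{h}_j\mathbf{x}\mathbf{x}^H\mathbf{h}_j^H=\zeta_j,\qquad j=1,\dots,K.$$ Let $d\in\mathbb{C}$ with $|d|=1$, let $\mathbf{A}\in\mathbb{C}^{K\times K}$ be the diagonal matrix with $j$-th diagonal entry $\exp\big(i(\angle d-\angle d_j)\big)$, and let $\mathbf{h}_{e,j}$ be the $j$-th row of the equivalent channel $\mathbf{H}_e=\mathbf{A}\mathbf{H}$. Then the optimal solution of $(\mathrm{CIPM})$ is given by the optimal solution of the constrained constellation multicast problem for the channel $\mathbf{H}_e$ and the common symbol $d$, $$\min_{\mathbf{x}_e\in\mathbb{C}^{M\times 1}} \ \mathbf{x}_e^H\mathbf{x}_e\quad\text{s.t.}\quad \angle(\mathbf{h}_{e,j}\mathbf{x}_e)=\angle(d),\quad \mathbf{h}_{e,j}\mathbf{x}_e\mathbf{x}_e^H\mathbf{h}_{e,j}^H=\zeta_j,\qquad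 j=1,\dots,K;$$ that is, a vector is optimal for $(\mathrm{CIPM})$ if and only if it is optimal for this multicast problem.
   Context: $(\cdot)^H$ denotes the Hermitian transpose and $i$ the imaginary unit. For a nonzero complex number $z$, $\angle z$ denotes its argument (angle modulo $2\pi$); a constraint $\angle(z)=\angle(d)$ requires $z\neq 0$. The $d_j$ are unit-modulus (M-PSK) data symbols, $\mathbf{h}_j$ is the channel of user $j$, $\mathbf{x}$ is the transmitted vector, and $\zeta_j$ is the SNR target of user $j$ with unit noise variance. *)

(* Defs.v *)
From HB Require Import structures.
From mathcomp Require Import all_boot all_order all_algebra.
From mathcomp Require Import all_classical all_reals all_analysis.
From mathcomp Require Import complex ring lra.

Set Implicit Arguments.
Unset Strict Implicit.
Unset Printing Implicit Defensive.

Import Order.TTheory GRing.Theory Num.Theory.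

Local Open Scope classical_set_scope.
Local Open Scope ring_scope.
Local Open Scope complex_scope.
Local Open Scope sesquilinear_scope.

Definition cexp (R : realType) (z : R[i]) : R[i] :=
  (expR (complex.Re z))%:C * (cos (complex.Im z) +i* sin (complex.Im z)).

(* An angle modulo 2 pi is represented by its value in ]-pi, pi].  For z <> 0
   the set below is a singleton (argP, arg_unique); arg 0 carries no meaning,
   and every use of it is guarded by z != 0. *)
Definition arg (R : realType) (z : R[i]) : R :=
  xget 0 [set t : R | - pi < t <= pi /\ z = `|z| * cexp ('i * t%:C)].

Definition same_angle (R : realType) (z w : R[i]) : Prop :=
  [/\ z != 0, w != 0 & arg z = arg w].

Lemma cexp_i (R : realType) (t : R) : cexp ('i * t%:C) = cos t +i* sin t.
Proof.
rewrite /cexp /=; simpc.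
by rewrite expR0; simpc.
Qed.

Lemma polar_exists (R : realType) (a b : R) : a ^+ 2 + b ^+ 2 = 1 ->
  exists2 t, - pi < t <= pi & cos t = a /\ sin t = b.
Proof.
move=> ab1.
have a1 : -1 <= a <= 1.
  by rewrite -ler_norml -(expr_le1 (n := 2)) // real_normK ?num_real //; nra.
have acosR : 0 <= acos a <= pi by rewrite acos_ge0 ?acos_lepi.
have ca := acosK a1.
have sa : sin (acos a) = `|b|.
  by rewrite sin_acos // -sqrtr_sqr; congr Num.sqrt; lra.
have pi0 := pi_gt0 R.
have [b0|b0] := leP 0 b.
  by exists (acos a); [lra | rewrite ca sa ger0_norm].
exists (- acos a); last by rewrite cosN sinN ca sa ltr0_norm ?opprK.
have : acos a != pi.
  apply/eqP => e; move: sa; rewrite e sinpi => /esym/eqP.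
  by rewrite normr_eq0 => /eqP b00; rewrite b00 ltxx in b0.
move=> ne; have := acosR; rewrite [acos a <= pi]le_eqVlt (negPf ne) /=.
lra.
Qed.

Lemma argP (R : realType) (z : R[i]) : z != 0 ->
  - pi < arg z <= pi /\ z = `|z| * cexp ('i * (arg z)%:C).
Proof.
move=> z0; apply: (@xgetPex _ 0
  [set t : R | - pi < t <= pi /\ z = `|z| * cexp ('i * t%:C)]).
case: z z0 => a b z0; set r : R := Num.sqrt (a ^+ 2 + b ^+ 2).
have rE : `|a +i* b| = r%:C by rewrite normc_def.
have r0 : r != 0.
  apply: contraNneq z0 => r0; by rewrite -normr_eq0 rE r0.
have r2 : r ^+ 2 = a ^+ 2 + b ^+ 2 by rewrite sqr_sqrtr ?addr_ge0 ?sqr_ge0.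
have [|t tI [ct st]] := @polar_exists R (a / r) (b / r).
  by rewrite !expr_div_n -mulrDl -r2 divff ?sqrf_eq0.
exists t; split=> //; rewrite cexp_i ct st rE; simpc.
by rewrite ![r * _]mulrC !divfK.
Qed.

Lemma arg_unique (R : realType) (z : R[i]) (t : R) : z != 0 ->
  - pi < t <= pi -> z = `|z| * cexp ('i * t%:C) -> arg z = t.
Proof.
move=> z0 tI zt; have [sI zs] := argP z0.
have : cexp ('i * (arg z)%:C) = cexp ('i * t%:C).
  by apply: (mulfI (x := `|z|)); rewrite ?normr_eq0 // -zs -zt.
rewrite !cexp_i; move: (arg z) sI => s sI [cst sst].
have : cos (s - t) = 1.
  by rewrite cosB cst sst -!expr2 cos2Dsin2.
have pi0 := pi_gt0 R.
have cos1 (u : R) : 0 <= u < pi + pi -> cos u = 1 -> u = 0.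
  move=> uI cu; have : cos (u / 2) ^+ 2 = 1.
    have := cosD (u / 2) (u / 2); rewrite -splitr cu.
    have := cos2Dsin2 (u / 2); rewrite -!expr2; lra.
  move=> c2; have s0 : sin (u / 2) = 0.
    apply/eqP; rewrite -sqrf_eq0; apply/eqP.
    by have := cos2Dsin2 (u / 2); lra.
  have [//|une0] := eqVneq u 0.
  have : 0 < u / 2 < pi.
    have : 0 < u by rewrite lt_neqAle eq_sym une0; case/andP: uI.
    lra.
  by move=> /sin_gt0_pi; rewrite s0 ltxx.
move=> cb; have [le|lt] := leP t s.
  by apply/eqP; rewrite -subr_eq0; apply/eqP/cos1 => //; lra.
apply/esym/eqP; rewrite -subr_eq0; apply/eqP/cos1; first lra.
by rewrite -opprB cosN.
Qed.

Definition optimal (T : Type) (D : numDomainType) (feasible : T -> Prop)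
    (obj : T -> D) (x : T) : Prop :=
  feasible x /\ forall y, feasible y -> obj x <= obj y.

Definition cipm_feasible (R : realType) (K M : nat) (H : 'M[R[i]]_(K, M))
    (d : 'rV[R[i]]_K) (zeta : 'rV[R]_K) (x : 'cV[R[i]]_M) : Prop :=
  forall j : 'I_K,
    same_angle ((row j H *m x) 0 0) (d 0 j) /\
    (row j H *m x *m x^t* *m (row j H)^t*) 0 0 = (zeta 0 j)%:C.

(* On R[i] the relation u <= v holds iff v - u is a nonnegative real, so it is
   only partial; the two objectives below take real values, on which it is the
   usual order. *)
Definition cipm_optimal (R : realType) (K M : nat) (H : 'M[R[i]]_(K, M))
    (d : 'rV[R[i]]_K) (zeta : 'rV[R]_K) : 'cV[R[i]]_M -> Prop :=
  optimal (cipm_feasible H d zeta) (fun x => \tr (x *m x^t*)).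

Definition multicast_feasible (R : realType) (K M : nat)
    (He : 'M[R[i]]_(K, M)) (d : R[i]) (zeta : 'rV[R]_K)
    (x : 'cV[R[i]]_M) : Prop :=
  forall j : 'I_K,
    same_angle ((row j He *m x) 0 0) d /\
    (row j He *m x *m x^t* *m (row j He)^t*) 0 0 = (zeta 0 j)%:C.

Definition multicast_optimal (R : realType) (K M : nat)
    (He : 'M[R[i]]_(K, M)) (d : R[i]) (zeta : 'rV[R]_K) :
    'cV[R[i]]_M -> Prop :=
  optimal (multicast_feasible He d zeta) (fun x => (x^t* *m x) 0 0).

Definition rotation_mx (R : realType) (K : nat) (d : R[i]) (ds : 'rV[R[i]]_K) :
    'M[R[i]]_K :=
  diag_mx (\row_j cexp ('i * (arg d - arg (ds 0 j))%:C)).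

(* Main.v *)
(* Left multiplication by [rotation_mx d ds] scales row j of H by the unit
   complex number exp(i(angle d - angle d_j)), which carries d_j to d.  This
   rotates h_j x and d_j together and leaves |h_j x|^2 unchanged, so the two
   problems have the same feasible set, and their objectives coincide because
   tr(x x^H) = x^H x. *)
Require Import Defs.
From mathcomp Require Import all_boot all_order all_algebra.
From mathcomp Require Import all_classical all_reals all_analysis.
From mathcomp Require Import complex.

Set Implicit Arguments.
Unset Strict Implicit.
Unset Printing Implicit Defensive.

Import Order.TTheory GRing.Theory Num.Theory.
Local Open Scope ring_scope.
Local Open Scope complex_scope.

Lemma cexp_iD (R : realType) (s t : R) :
  cexp ('i * (s + t)%:C) = cexp ('i * s%:C) * cexp ('i * t%:C).
Proof.
by rewrite !cexp_i cosD sinD; simpc; congr (_ +i* _); rewrite addrC.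
Qed.

Lemma norm_cexp_i (R : realType) (t : R) : `|cexp ('i * t%:C)| = 1.
Proof. by rewrite cexp_i normc_def /= cos2Dsin2 sqrtr1. Qed.

Lemma unit_normE (R : realType) (z : R[i]) : `|z| = 1 ->
  z = cexp ('i * (arg z)%:C).
Proof.
move=> z1; have z0 : z != 0 by rewrite -normr_eq0 z1 oner_eq0.
by have [_] := argP z0; rewrite z1 mul1r.
Qed.

(** Trades arguments, defined only modulo 2 pi, for a polynomial relation: a unit [w] is itself the
    phase factor in the polar form of [z]. *)
Lemma same_angle_unit (R : realType) (z w : R[i]) : `|w| = 1 ->
  same_angle z w <-> z != 0 /\ z = `|z| * w.
Proof.
move=> w1; have w0 : w != 0 by rewrite -normr_eq0 w1 oner_eq0.
split=> [[z0 _ zw]|[z0 zE]]; split=> //.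
  by rewrite (unit_normE w1) -zw; have [_] := argP z0.
(* [arg w] already lies in the principal range, so only the polar form of [z] with angle [arg w]
   remains. *)
apply: arg_unique => //; first by have [] := argP w0.
by rewrite -(unit_normE w1).
Qed.

(** In the multiplicative form the common factor [u] cancels, so no wrap-around of angles has to be
    tracked. *)
Lemma same_angle_rotate (R : realType) (u z w : R[i]) : `|u| = 1 -> `|w| = 1 ->
  same_angle (u * z) (u * w) <-> same_angle z w.
Proof.
move=> u1 w1; have u0 : u != 0 by rewrite -normr_eq0 u1 oner_eq0.
rewrite !same_angle_unit ?normrM ?u1 ?w1 ?mulr1 //.
rewrite mulf_eq0 (negPf u0) mul1r mulrCA.
by split=> -[z0 zE]; split=> //; [exact: (mulfI u0) | rewrite -zE].
Qed.

(** The difference of arguments may leave ]-pi, pi]; this is harmless, since only the addition law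
    of [cexp] is applied to it. *)
Lemma rotation_unit (R : realType) (d w : R[i]) : `|d| = 1 -> `|w| = 1 ->
  cexp ('i * (arg d - arg w)%:C) * w = d.
Proof.
by move=> d1 w1; rewrite {2}(unit_normE w1) -cexp_iD subrK -(unit_normE d1).
Qed.

Local Open Scope sesquilinear_scope.

(** The two outer factors contribute [u] times its conjugate, which is |u|^2 = 1. *)
Lemma quad_rotate (R : realType) (M : nat) (u : R[i]) (h : 'rV[R[i]]_M)
    (x : 'cV[R[i]]_M) : `|u| = 1 ->
  (u *: h) *m x *m x^t* *m (u *: h)^t* = h *m x *m x^t* *m h^t*.
Proof.
move=> u1; rewrite linearZ /= map_mxZ -!scalemxAl -scalemxAr scalerA.
by rewrite -normCK u1 expr1n scale1r.
Qed.

Lemma multicast_feasibleE (R : realType) (K M : nat) (H : 'M[R[i]]_(K, M))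
    (ds : 'rV[R[i]]_K) (zeta : 'rV[R]_K) (d : R[i]) (x : 'cV[R[i]]_M) :
    (forall j, `|ds 0 j| = 1) -> `|d| = 1 ->
  multicast_feasible (rotation_mx d ds *m H) d zeta x <->
  cipm_feasible H ds zeta x.
Proof.
move=> hds hd.
have row_rot j : row j (rotation_mx d ds *m H) =
    cexp ('i * (arg d - arg (ds 0 j))%:C) *: row j H.
  by apply/rowP => k; rewrite mul_diag_mx !mxE.
have angleE j : same_angle ((row j (rotation_mx d ds *m H) *m x) 0 0) d <->
    same_angle ((row j H *m x) 0 0) (ds 0 j).
  (* The target symbol [d], but not the one inside [rotation_mx], is written as the rotated
     [ds 0 j], so both angles carry the same unit factor. *)
  rewrite -{2}(rotation_unit hd (hds j)) row_rot -scalemxAl mxE.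
  by apply: same_angle_rotate; rewrite ?norm_cexp_i.
have normE j : row j (rotation_mx d ds *m H) *m x *m x^t*
    *m (row j (rotation_mx d ds *m H))^t* =
    row j H *m x *m x^t* *m (row j H)^t*.
  by rewrite row_rot quad_rotate ?norm_cexp_i.
by split=> feas j; have [/angleE aj zj] := feas j; split=> //;
  [rewrite -normE | rewrite normE].
Qed.

Theorem theorem1 (R : realType) (K M : nat) (hK : (0 < K)%N) (hM : (0 < M)%N)
    (H : 'M[R[i]]_(K, M)) (ds : 'rV[R[i]]_K) (hds : forall j, `|ds 0 j| = 1)
    (zeta : 'rV[R]_K) (hzeta : forall j, 0 < zeta 0 j)
    (d : R[i]) (hd : `|d| = 1) (x : 'cV[R[i]]_M) :
  cipm_optimal H ds zeta x <->
  multicast_optimal (rotation_mx d ds *m H) d zeta x.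
Proof.
have trE (y : 'cV[R[i]]_M) : \tr (y *m y^t*) = (y^t* *m y) 0 0.
  (* Cyclicity of the trace leaves a 1 x 1 matrix. *)
  by rewrite mxtrace_mulC /mxtrace big_ord1.
have feasE y := multicast_feasibleE H zeta y hds hd.
by split=> -[/feasE xfeas opt]; split=> // y /feasE /opt; rewrite !trE.
Qed.
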